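(* Let $P,Q\in\mathbb{R}[x]$ be two polynomials of the same degree $k$ such that all roots of $P$ are real and of the same sign, and all roots of $Q$ are real and of the same sign (for each polynomial, all strictly positive or all strictly negative). Let $P*Q$ be their Schur–Szegő product. Then $$\mathrm{lmesh}(P*Q)\ \ge\ \max\bigl(\mathrm{lmesh}(P),\mathrm{lmesh}(Q)\bigr).$$ (In particular, the roots of $P*Q$ are all real and of the same sign, so that $\mathrm{lmesh}(P*Q)$ is defined.)
   Context: The Schur–Szegő product of two polynomials of degree $k$ written as $P(x)=\sum_{j=0}^k\binom{k}{j}a_jx^j$ and $Q(x)=\sum_{j=0}^k\binom{k}{j}b_jx^j$ is $$(P*Q)(x)=\sum_{j=0}^k\binom{k}{j}a_jb_jx^j.$$ Let $P$ be a real polynomial of degree $k$ all of whose roots are real and of the same sign (all strictly positive or all strictly negative). List its roots with multiplicity, ordered so that $|x_1|\le |x_2|\le\dots\le |x_k|$. The logarithmic mesh of $P$ is $$\mathrm{lmesh}(P)=\min_{j=1,\dots,k-1}\frac{|x_{j+1}|}{|x_j|}.$$ When $k\le 1$ the minimum is over the empty set and is understood to be $+\infty$. *)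

(* Defs.v *)
(* MathComp / MathComp-Analysis; [R : realType] plays the role of the reals. *)
From mathcomp Require Import all_boot all_order all_algebra.
From mathcomp Require Import boolp classical_sets reals constructive_ereal.
From mathcomp Require Import complex.
Set Implicit Arguments. Unset Strict Implicit. Unset Printing Implicit Defensive.
Import Order.TTheory GRing.Theory Num.Theory.
Local Open Scope ring_scope.

(* The a_j such that P = \sum_(j <= k) 'C(k, j) a_j X^j, for P of degree <= k. *)
Definition bin_coef (R : realType) (k : nat) (P : {poly R}) (j : nat) : R :=
  P`_j / 'C(k, j)%:R.

Definition schur_szego (R : realType) (k : nat) (P Q : {poly R}) : {poly R} :=
  \sum_(j < k.+1) ('C(k, j)%:R * bin_coef k P j * bin_coef k Q j) *: 'X^j.

(* The roots range over the complex numbers [R[i]], so that "all roots are real"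
   has content. The zero polynomial satisfies neither disjunct; a nonzero
   constant satisfies both. *)
Definition roots_real_same_sign (R : realType) (P : {poly R}) : Prop :=
  (forall z : R[i], root (map_poly (real_complex R) P) z ->
     exists2 x : R, 0 < x & z = real_complex R x) \/
  (forall z : R[i], root (map_poly (real_complex R) P) z ->
     exists2 x : R, x < 0 & z = real_complex R x).

Definition is_ordered_root_list (R : realType) (P : {poly R}) (s : seq R) : Prop :=
  P = lead_coef P *: \prod_(x <- s) ('X - x%:P) /\
  sorted (fun x y : R => `|x| <= `|y|) s.

(* When [roots_real_same_sign P] holds, exactly one list satisfies
   [is_ordered_root_list P]. The default [::] is only reached when P does not
   split over R. *)
Definition ordered_roots (R : realType) (P : {poly R}) : seq R :=
  xget [::] [set s | is_ordered_root_list P s]%classic.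

(* Indices are shifted to start at 0; the neutral element +oo is the value when
   there are at most one root. Meaningful only under [roots_real_same_sign P]. *)
Definition lmesh (R : realType) (P : {poly R}) : \bar R :=
  let s := ordered_roots P in
  \big[Order.min/+oo%E]_(j < (size s).-1) (`|s`_j.+1| / `|s`_j|)%:E.

(* Main.v *)
Require Import Defs.
From mathcomp Require Import all_boot all_order all_algebra.
From mathcomp Require Import boolp classical_sets reals constructive_ereal.
From mathcomp Require Import complex polyrcf ring lra.
Set Implicit Arguments. Unset Strict Implicit. Unset Printing Implicit Defensive.
Import Order.TTheory GRing.Theory Num.Theory.
Local Open Scope ring_scope.

(** The engine is the half-plane case of the Grace-Szego theorem
    ([grace_szego]). Let [H] be an open half-plane bounded by a line through 0,
    written throughout as the set of [x] with [0 < Im (v * x)]. If a complex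
    polynomial [f] of degree at most [k] does not vanish on [H] and [z / b] lies
    in [H] for each of the [k] numbers [b], then the Schur-Szego product of [f]
    with the product of the [X + b] does not vanish at [z]. Splitting off one
    factor [X + b] turns the value at this fixed [z] into the value of a product
    of degree one less, in which [f] is replaced by its polar derivative with
    pole [z / b] ([szego_polar]); since the pole lies in [H], Laguerre's theorem
    ([laguerre]) says that the polar derivative still does not vanish on [H].

    Let the roots of [P] have sign [sg] and those of [Q] sign [tg]. Taking for
    [f] the polynomial [P] itself, with suitable half-planes, shows that the
    product [S] of [P] and [Q] has only real roots, all of sign [-(sg * tg)]
    ([szego_roots_sign]).

    The mesh of [P] is at least [1/s] exactly when the roots of [P(X)] and
    [P(s X)] interlace, and then the angle of [P(s z) / P(z)] stays in [0, pi]
    as [z] runs through the half-plane [0 < Im (sg * z)] ([mesh_scaled_angle]).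
    Equivalently, [P(s X) + w P(X)] has no zero there when [Im w > 0]. The
    product with [Q] is linear and commutes with the scaling of the variable, so
    by Grace-Szego [S(s X) + w S(X)] has no zero in the half-plane attached to
    [S], and the angle of [S(s z) / S(z)] lies in [0, pi] as well
    ([szego_angle]).

    This holds for every [s] in an interval [s0 <= s < 1], where [1/s0] is the
    mesh of [P]. Letting [z] tend to a root [y] of [S] forces the root to be
    simple, and forces [S(s y)] to keep the same sign for all these [s]; a
    second root strictly between [s0 y] and [y] would change that sign
    ([angle_root_gap]). Hence consecutive roots of [S] have ratio at least
    [1/s0], and the bound by the mesh of [Q] follows by commutativity. *)

(** * Schur-Szego products over a field *)

(** The [j]-th coefficients of the factors are [C(k, j) a_j] and [C(k, j) b_j];
    dividing their product once by [C(k, j)] leaves [C(k, j) a_j b_j]. *)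
Definition szego (F : fieldType) (k : nat) (f g : {poly F}) : {poly F} :=
  \poly_(j < k.+1) (f`_j * g`_j / 'C(k, j)%:R).

(** When [f] has degree [n] this is [n f + (x - X) f'], the polar derivative of
    [f] with pole [x]; a smaller degree counts as missing roots at infinity. *)
Definition polar (F : fieldType) (n : nat) (x : F) (f : {poly F}) : {poly F} :=
  n%:R *: f + (x%:P - 'X) * f^`().

Lemma schur_szegoE (R : realType) k (P Q : {poly R}) :
  schur_szego k P Q = szego k P Q.
Proof.
rewrite /szego poly_def; apply: eq_bigr => j _; congr (_ *: _).
have Cn0 : 'C(k, j)%:R != 0 :> R.
  by rewrite pnatr_eq0 -lt0n bin_gt0 -ltnS ltn_ord.
by rewrite /bin_coef; field.
Qed.

Lemma szegoC (F : fieldType) k (f g : {poly F}) : szego k f g = szego k g f.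
Proof. by apply: eq_poly => j _; rewrite [f`_j * _]mulrC. Qed.

Lemma map_szego (F K : fieldType) (h : {rmorphism F -> K}) k (f g : {poly F}) :
  map_poly h (szego k f g) = szego k (map_poly h f) (map_poly h g).
Proof.
apply/polyP => j; rewrite coef_map -[LHS]/(h (szego k f g)`_j) !(coef_poly k.+1).
case: ifP => _; last exact: rmorph0.
by rewrite !coef_map fmorph_div rmorphM rmorph_nat.
Qed.

Lemma szegoDl (F : fieldType) k (f1 f2 g : {poly F}) :
  szego k (f1 + f2) g = szego k f1 g + szego k f2 g.
Proof.
apply/polyP => j; rewrite coefD !coef_poly; case: ifP => _; last by rewrite addr0.
by rewrite coefD !mulrDl.
Qed.

Lemma szegoZl (F : fieldType) k c (f g : {poly F}) :
  szego k (c *: f) g = c *: szego k f g.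
Proof.
apply/polyP => j; rewrite coefZ !coef_poly; case: ifP => _; last by rewrite mulr0.
by rewrite coefZ !mulrA.
Qed.

Lemma szegoZr (F : fieldType) k c (f g : {poly F}) :
  szego k f (c *: g) = c *: szego k f g.
Proof. by rewrite szegoC szegoZl szegoC. Qed.

Lemma size_szego (F : numFieldType) k (P Q : {poly F}) :
  size P = k.+1 -> size Q = k.+1 -> size (szego k P Q) = k.+1.
Proof.
move=> szP szQ; apply: size_poly_eq; rewrite binn divr1.
have <- : lead_coef P = P`_k by rewrite lead_coefE szP.
have <- : lead_coef Q = Q`_k by rewrite lead_coefE szQ.
by rewrite mulf_neq0 // lead_coef_eq0 -size_poly_gt0 ?szP ?szQ.
Qed.

Lemma coef_comp_scale (F : fieldType) (s : F) (f : {poly F}) j :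
  (f \Po (s *: 'X))`_j = f`_j * s ^+ j.
Proof.
rewrite comp_polyE -[in RHS](coefK f) coef_poly coef_sum.
under eq_bigr do rewrite exprZn !coefZ coefXn.
case: ltnP => [jf|fj].
  rewrite (bigD1 (Ordinal jf)) //= eqxx mulr1 big1 ?addr0 // => i.
  by rewrite -val_eqE eq_sym /= => /negbTE ->; rewrite !mulr0.
rewrite mul0r big1 // => i _.
have /negbTE -> : j != i by rewrite neq_ltn (leq_trans (ltn_ord i) fj) orbT.
by rewrite !mulr0.
Qed.

Lemma szego_comp_scale (F : fieldType) k s (f g : {poly F}) :
  szego k (f \Po (s *: 'X)) g = szego k f g \Po (s *: 'X).
Proof.
apply/polyP => j; rewrite coef_comp_scale !coef_poly.
by case: ifP => _; rewrite ?mul0r // coef_comp_scale; ring.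
Qed.

(** The terms of top degree of [n f] and [X f'] cancel, which is what makes
    induction on the degree possible. *)
Lemma size_polar (F : fieldType) k (x : F) (f : {poly F}) :
  (size f <= k.+2)%N -> (size (polar k.+1 x f) <= k.+1)%N.
Proof.
move=> szf; apply/leq_sizeP => j kj.
rewrite coefD coefZ mulrBl coefB coefCM coefXM !coef_deriv.
have f0 i : (k.+1 < i)%N -> f`_i = 0 by move=> ki; rewrite nth_default // (leq_trans szf).
case: j kj => // j kj; rewrite (f0 j.+2) ?ltnS // mul0rn mulr0 /=.
have [->|jk] := eqVneq j k; first by rewrite mulr_natl sub0r addrN.
by rewrite f0 ?mul0rn ?mulr0 ?subrr ?addr0 // ltnS ltn_neqAle eq_sym jk.
Qed.

(** One factor [X + b] of the second polynomial is absorbed into the first. The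
    point [z] is fixed, so it may serve as a parameter of the new first
    polynomial: the shift of coefficients caused by [X] contributes
    [(z / b) f'] and the constant [b] contributes [(k + 1) f - X f'], up to the
    common factor [b / (k + 1)]. *)
Lemma szego_polar (F : numFieldType) k (b z : F) (f Q : {poly F}) :
    b != 0 -> (size Q <= k.+1)%N ->
  (szego k.+1 f (('X + b%:P) * Q)).[z] =
  b / k.+1%:R * (szego k (polar k.+1 (z / b) f) Q).[z].
Proof.
move=> b0 szQ; rewrite !horner_poly big_distrr /=.
under eq_bigr do rewrite mulrDl coefD coefXM coefCM mulrDr !mulrDl.
rewrite big_split /= big_ord_recl /= mulr0 !mul0r add0r.
rewrite [X in _ + X]big_ord_recr /= (nth_default _ szQ) !mulr0 !mul0r addr0.
rewrite -big_split /=; apply: eq_bigr => j _.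
rewrite coefD coefZ mulrBl coefB coefCM coefXM !coef_deriv /bump /= add1n.
have k0 : k.+1%:R != 0 :> F by rewrite pnatr_eq0.
have jk : (j <= k)%N by rewrite -ltnS.
have c0 : 'C(k, j)%:R != 0 :> F by rewrite pnatr_eq0 -lt0n bin_gt0.
have e1 : k.+1%:R * 'C(k, j)%:R = j.+1%:R * 'C(k.+1, j.+1)%:R :> F.
  by rewrite -!natrM -mul_bin_diag.
have e2 : k.+1%:R * 'C(k, j)%:R = (k.+1%:R - j%:R) * 'C(k.+1, j)%:R :> F.
  by rewrite -natrB ?leqW // -!natrM -(mul_bin_down k.+1 j).
have j0 : j.+1%:R != 0 :> F by rewrite pnatr_eq0.
have kj0 : k.+1%:R - j%:R != 0 :> F by rewrite -natrB ?leqW // pnatr_eq0 subn_eq0 -ltnNge.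
have -> : 'C(k.+1, j.+1)%:R = k.+1%:R * 'C(k, j)%:R / j.+1%:R :> F.
  by rewrite e1 mulrAC mulfV ?mul1r.
have -> : 'C(k.+1, j)%:R = k.+1%:R * 'C(k, j)%:R / (k.+1%:R - j%:R) :> F.
  by rewrite e2 mulrAC mulfV ?mul1r.
have -> : (if j == 0%N :> nat then 0 else f`_j.-1.+1 *+ j.-1.+1) = f`_j * j%:R :> F.
  by case: (nat_of_ord j) => [|i] /=; rewrite ?mulr0 // mulr_natr.
rewrite -mulr_natr exprS.
field.
by rewrite !nat1r c0 b0 k0 kj0 j0.
Qed.

(** * Laguerre's and Grace's theorems for half-planes *)

Section HalfPlane.
Variable R : rcfType.
Local Notation C := R[i].
Local Notation Im := (@complex.Im R).
Local Notation "x %:C" := (real_complex R x).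
Local Notation "p ^C" :=
  (map_poly (real_complex R) p) (at level 1, format "p ^C").

Lemma le_norm_complex x z :
  (`|x| <= `|z|) =
  (complex.Re x ^+ 2 + Im x ^+ 2 <= complex.Re z ^+ 2 + Im z ^+ 2).
Proof.
by rewrite !normc_def lecR ler_sqrt ?addr_ge0 ?sqr_ge0.
Qed.

(** Inversion maps the half-plane [t <= Im p] onto a closed disc tangent to the
    real axis at 0, less the point 0. The convexity of that disc is what Laguerre's theorem uses. *)
Lemma inverse_disc t p : 0 < t -> p != 0 ->
  (`|(2 * t)%:C / p + 'i%C| <= 1) = (t <= Im p).
Proof.
move=> t0 p0; have -> : (2 * t)%:C / p + 'i%C = ((2 * t)%:C + 'i%C * p) / p by field.
rewrite normrM normfV ler_pdivrMr ?normr_gt0 // mul1r le_norm_complex.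
case: p {p0} => a b /=; rewrite !mul0r !mul1r sub0r add0r.
apply/idP/idP => h; last by nra.
by rewrite leNgt; apply/negP => bt; nra.
Qed.

Lemma Im_sub_gt0_neq0 v x z : Im (v * z) < Im (v * x) -> v * (x - z) != 0.
Proof.
by move=> h; apply/eqP => e; move: h; rewrite -subr_gt0 -raddfB -mulrBr e ltxx.
Qed.

(** The logarithmic derivative is a sum of inverses, one for each root, and each
    inverse lies in the disc of [inverse_disc]; a sum of [n] points of a disc
    lies in the disc dilated by [n]. The factor [v] makes the half-plane
    upright. *)
Lemma log_deriv_disc v x (rs : seq C) :
    0 < Im (v * x) -> {in rs, forall r, Im (v * r) <= 0} ->
  let p := \prod_(r <- rs) ('X - r%:P) in
  exists2 W, p^`().[x] = p.[x] * (v * W) &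
    `|(2 * Im (v * x))%:C * W + (size rs)%:R * 'i%C| <= (size rs)%:R.
Proof.
move=> vx0; elim: rs => [|r rs IH] hr /=.
  exists 0; first by rewrite !big_nil -[1]/(1%:P) derivC horner0 !mulr0.
  by rewrite mulr0 mul0r addr0 normr0.
have [W dW hW] := IH (fun s hs => hr s (@mem_behead _ (r :: rs) s hs)).
have r0 := hr r (mem_head _ _).
have p0 := Im_sub_gt0_neq0 (le_lt_trans r0 vx0).
exists ((v * (x - r))^-1 + W).
  rewrite !big_cons derivM derivXsubC mul1r hornerD !hornerM hornerXsubC dW.
  move: p0; rewrite mulf_eq0 negb_or => /andP[v0 xr0]; field.
  by rewrite v0 xr0.
rewrite /= -[leRHS]natr1 -[X in `|_ + X * _|]natr1; set n := (size rs)%:R in hW *.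
rewrite [X in `|X|](_ : _ =
  ((2 * Im (v * x))%:C * W + n * 'i%C) + ((2 * Im (v * x))%:C / (v * (x - r)) + 'i%C));
  last by ring.
apply: (le_trans (ler_normD _ _)). apply: lerD => //.
rewrite inverse_disc // mulrBr raddfB lerBrDr gerDl //.
Qed.

(** If the polar derivative vanished at [x], the inverse of [v * (x - zeta)] would
    be an average of [k + 1] points of the disc of [inverse_disc]: one for each
    root of [f], and the boundary point 0 for each missing degree. This would
    put the pole [zeta] outside the half-plane. *)
Lemma laguerre k v (f : {poly C}) (x zeta : C) :
    f != 0 -> (size f <= k.+2)%N -> (forall z, 0 < Im (v * z) -> f.[z] != 0) ->
    0 < Im (v * x) -> 0 < Im (v * zeta) ->
  (polar k.+1 zeta f).[x] != 0.
Proof.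
move=> f0 szf nz vx vz.
have [rs frs] := closed_field_poly_normal f.
have hr : {in rs, forall r, Im (v * r) <= 0}.
  move=> r hr; rewrite leNgt; apply/negP => /nz /negP; apply.
  rewrite frs hornerZ mulf_eq0; apply/orP; right.
  by rewrite -/(root _ _) root_prod_XsubC.
have [W dW hW] := log_deriv_disc vx hr.
set p := \prod_(r <- rs) _ in frs dW.
have szrs : (size rs <= k.+1)%N.
  by move: szf; rewrite frs size_scale ?lead_coef_eq0 // size_prod_XsubC ltnS.
have fx0 := nz x vx.
rewrite !hornerE.
have -> : f^`().[x] = f.[x] * (v * W).
  by rewrite frs derivZ !hornerZ dW mulrA.
apply/eqP => e.
have {}e : v * (x - zeta) * W = k.+1%:R.
  by apply: (mulfI fx0); move/eqP: e; rewrite addr_eq0 => /eqP e; rewrite [RHS]mulrC e; ring.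
have p0 : v * (x - zeta) != 0.
  by apply/eqP => h; move/eqP: e; rewrite h mul0r eq_sym pnatr_eq0.
have WE : W = k.+1%:R / (v * (x - zeta)) by rewrite -e mulrAC mulfV // mul1r.
suff : `|(2 * Im (v * x))%:C / (v * (x - zeta)) + 'i%C| <= 1.
  by rewrite inverse_disc // mulrBr raddfB lerBrDr gerDl leNgt vz.
rewrite -(ler_pM2l (x := k.+1%:R)) ?ltr0n // mulr1.
rewrite -{1}[k.+1%:R]normr_nat -normrM.
have -> : k.+1%:R * ((2 * Im (v * x))%:C / (v * (x - zeta)) + 'i%C) =
  ((2 * Im (v * x))%:C * W + (size rs)%:R * 'i%C) + (k.+1 - size rs)%:R * 'i%C.
  by rewrite WE natrB //; ring.
apply: (le_trans (ler_normD _ _)).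
have -> : k.+1%:R = (size rs)%:R + (k.+1 - size rs)%:R :> C by rewrite -natrD subnKC.
apply: lerD => //.
rewrite normrM normr_nat (_ : `|'i%C| = 1) ?mulr1 //.
by rewrite normc_def /= expr0n /= add0r expr1n sqrtr1.
Qed.

(** Grace-Szego theorem for a half-plane, by removing the [b] one at a time with
    [szego_polar]. A zero [b] is excluded by the last hypothesis, because
    [z / 0 = 0] is on the boundary line. *)
Theorem grace_szego v (f : {poly C}) (bs : seq C) (z : C) :
    f != 0 -> (size f <= (size bs).+1)%N ->
    (forall x, 0 < Im (v * x) -> f.[x] != 0) ->
    {in bs, forall b, 0 < Im (v * (z / b))} ->
  (szego (size bs) f (\prod_(b <- bs) ('X + b%:P))).[z] != 0.
Proof.
elim: bs f => [|b bs IH] f f0 szf nz hb /=.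
  have /size1_polyC fc : (size f <= 1)%N := szf.
  rewrite big_nil /szego poly_def big_ord1 bin0 coef1 eqxx !hornerE divr1.
  by move: f0; rewrite fc polyC_eq0 coefC eqxx.
have vb := hb b (mem_head _ _).
have b0 : b != 0 by apply: contraTneq vb => ->; rewrite invr0 !mulr0 ltxx.
rewrite big_cons szego_polar //; last first.
  under eq_bigr do rewrite -[_%:P]opprK -polyCN.
  by rewrite size_prod_XsubC.
rewrite mulf_neq0 ?mulf_neq0 ?invr_eq0 ?pnatr_eq0 //.
have nz' x : 0 < Im (v * x) -> (polar (size bs).+1 (z / b) f).[x] != 0.
  by move=> vx; exact: laguerre f0 szf nz vx vb.
apply: IH => //.
- by apply: contraNneq (nz' _ vb) => ->; rewrite horner0.
- exact: size_polar.
- by move=> c cb; apply: hb; rewrite mem_behead.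
Qed.

(** * Interlacing as a bound on an angle *)

(** The angle of the product is the sum of the angles under which the segments
    from [a] to [a / s] are seen from [z]. The path condition makes these
    segments disjoint, so the sum is at most [pi]. The induction adds the
    segments from left to right and carries two facts on the accumulated number
    [phi]: its angle is between 0 and [pi], and it is at most the angle of
    [s z - a0], where [a0 / s] is the right end of the last segment. *)
Lemma interlacing_angle (s : R) (z : C) (l : seq R) (a0 : R) (phi : C) :
    0 < s <= 1 -> 0 <= a0 -> path (fun a b => a <= s * b) a0 l ->
    0 <= Im phi -> Im (phi * conjc (s%:C * z - a0%:C)) <= 0 ->
  0 <= Im (phi * \prod_(a <- l) ((s%:C * z - a%:C) * conjc (z - a%:C))).
Proof.
case/andP=> s0 s1; elim: l a0 phi => [|a l IH] a0 phi a00 /=.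
  by rewrite big_nil mulr1.
case/andP=> a0a al phi0 phi1; rewrite big_cons mulrA.
have a_ge0 : 0 <= a by nra.
(* up to a positive factor, psi is phi with its angle lowered by that of z - a *)
pose psi := phi * conjc (z - a%:C).
have psi_le0 : Im psi <= 0.
  rewrite -(ler_pM2l s0) mulr0; apply: le_trans phi1.
  rewrite /psi; case: phi phi0 {IH psi} => p q /=; case: z => x y /= q0.
  rewrite !mul0r !subr0 !addr0 -subr_ge0.
  have : 0 <= q * (s * a - a0) by rewrite mulr_ge0 ?subr_ge0.
  by lra.
apply: (IH a) => //.
  have phiE : Im (phi * ((s%:C * z - a%:C) * conjc (z - a%:C))) =
    s * (Im phi * ((complex.Re z - a) ^+ 2 + Im z ^+ 2)) + (s - 1) * a * Im psi.
    rewrite /psi; case: (phi) => p q; case: (z) => x y /=; ring.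
  rewrite phiE; have := mulr_ge0 phi0 (addr_ge0 (sqr_ge0 (complex.Re z - a)) (sqr_ge0 (Im z))).
  move/(mulr_ge0 (ltW s0)) => h; rewrite addr_ge0 // mulr_le0 //.
  by rewrite mulr_le0_ge0 // subr_le0.
have -> : Im (phi * ((s%:C * z - a%:C) * conjc (z - a%:C)) * conjc (s%:C * z - a%:C)) =
    Im psi * ((s * complex.Re z - a) ^+ 2 + (s * Im z) ^+ 2).
  rewrite /psi; case: (phi) => p q; case: (z) => x y /=; ring.
by rewrite mulr_le0_ge0 ?addr_ge0 ?sqr_ge0.
Qed.

Lemma conjc_horner (p : {poly R}) (z : C) :
  conjc (p^C.[z]) = p^C.[conjc z].
Proof.
rewrite -horner_map; congr (_.[_]); apply/polyP => i.
by rewrite !coef_map /= oppr0.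
Qed.

Lemma Im_realM (a : R) (z : C) : Im (a%:C * z) = a * Im z.
Proof. by case: z => x y /=; rewrite mul0r addr0. Qed.

Lemma conjc_realM (a : R) (z : C) : conjc (a%:C * z) = a%:C * conjc z.
Proof. by rewrite rmorphM /= oppr0. Qed.

Lemma horner_map_prod_roots (c : R) (rs : seq R) (z : C) :
  (c *: \prod_(r <- rs) ('X - r%:P))^C.[z] =
  c%:C * \prod_(r <- rs) (z - r%:C).
Proof.
rewrite map_polyZ map_prod_XsubC hornerZ horner_prod; congr (_ * _).
by apply: eq_bigr => r _; rewrite hornerXsubC.
Qed.

(** Multiplying the variable by the common sign [sg] of the roots replaces each
    root by its absolute value, the situation of [interlacing_angle]. *)
Lemma mesh_scaled_angle (sg s c : R) (rs : seq R) (z : C) (P : {poly R}) :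
    P = c *: \prod_(r <- rs) ('X - r%:P) ->
    sg ^+ 2 = 1 -> 0 < s <= 1 -> {in rs, forall r, 0 < sg * r} ->
    sorted (fun x y => `|x| <= s * `|y|) rs -> 0 < Im (sg%:C * z) ->
  0 <= Im (P^C.[s%:C * z] * conjc P^C.[z]).
Proof.
move=> -> sg2 s01 rs_gt0 rs_mesh z0.
have sgC : sg%:C * sg%:C = 1 by rewrite -rmorphM -expr2 sg2.
have sg1 : `|sg| = 1.
  by apply/eqP; rewrite -(@eqrXn2 _ 2) // -normrX sg2 normr1 expr1n.
have conjE : conjc (c%:C * \prod_(r <- rs) (z - r%:C)) =
    c%:C * \prod_(r <- rs) conjc (z - r%:C).
  by rewrite conjc_realM rmorph_prod.
rewrite !horner_map_prod_roots conjE.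
rewrite mulrACA -big_split /= -rmorphM Im_realM mulr_ge0 -?expr2 ?sqr_ge0 //.
have -> : \prod_(r <- rs) ((s%:C * z - r%:C) * conjc (z - r%:C)) =
   1 * \prod_(a <- map Num.norm rs)
     ((s%:C * (sg%:C * z) - a%:C) * conjc (sg%:C * z - a%:C)).
  rewrite mul1r big_map; apply: eq_big_seq => r hr.
  have -> : `|r| = sg * r by rewrite -(gtr0_norm (rs_gt0 r hr)) normrM sg1 mul1r.
  rewrite [_ * (_ * z)]mulrCA rmorphM -!mulrBr conjc_realM.
  by rewrite mulrACA sgC mul1r.
apply: (@interlacing_angle s _ _ 0) => //.
- case: rs rs_mesh {rs_gt0 conjE} => //= r rs; rewrite path_map /= => ->.
  by rewrite andbT mulr_ge0 // ltW //; case/andP: s01.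
- rewrite subr0 mul1r conjc_realM Im_realM.
  case/andP: s01 => s_gt0 _; move: z0; case: (_ * z) => x y /= y0.
  by rewrite mulrN oppr_le0 mulr_ge0 // ltW.
Qed.

(** [grace_szego] for a real second factor written by its roots: with [b = -q],
    the point [z / b] lies in the half-plane exactly when [Im (v * z)] and [q]
    have opposite signs. *)
Lemma szego_half_plane v (f : {poly C}) (d : R) (qs : seq R) (z : C) :
    d != 0 -> f != 0 -> (size f <= (size qs).+1)%N ->
    (forall x, 0 < Im (v * x) -> f.[x] != 0) ->
    {in qs, forall q, Im (v * z) * q < 0} ->
  (szego (size qs) f (d *: \prod_(q <- qs) ('X - q%:P))^C).[z] != 0.
Proof.
move=> d0 f0 szf nz hq.
rewrite map_polyZ szegoZr hornerZ mulf_neq0 ?fmorph_eq0 //.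
pose bs := [seq (- q)%:C | q <- qs].
have -> : (\prod_(q <- qs) ('X - q%:P))^C = \prod_(b <- bs) ('X + b%:P).
  rewrite map_prod_XsubC big_map; apply: eq_bigr => q _.
  by rewrite rmorphN polyCN.
have -> : size qs = size bs by rewrite size_map.
apply: grace_szego nz _ => //; first by rewrite size_map.
move=> _ /mapP[q /hq vq ->].
have q0 : q != 0 by apply: contraTneq vq => ->; rewrite mulr0 ltxx.
rewrite mulrA -fmorphV mulrC Im_realM.
have -> : (- q)^-1 * Im (v * z) = (- (Im (v * z) * q)) / q ^+ 2 by field.
by rewrite divr_gt0 ?oppr_gt0 // exprn_even_gt0.
Qed.

(** * From the angle bound back to gaps between roots *)

Lemma poly_ge0_right (p : {poly R}) (a b : R) :
  a < b -> (forall t, a < t < b -> 0 <= p.[t]) -> 0 <= p.[a].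
Proof.
move=> ab p0; rewrite leNgt; apply/negP => pa.
have pa' : 0 < - p.[a] by rewrite oppr_gt0.
have [d d0 hd] := poly_cont a p pa'.
pose e := Num.min (d / 2) ((b - a) / 2).
have e0 : 0 < e by rewrite lt_min !divr_gt0 // subr_gt0.
have ed : e <= d / 2 by rewrite ge_min lexx.
have eb : e <= (b - a) / 2 by rewrite ge_min lexx orbT.
have := hd (a + e); rewrite addrAC subrr add0r gtr0_norm // => /(_ _) h.
have {}h : `|p.[a + e] - p.[a]| < - p.[a] by apply: h; lra.
have := p0 (a + e); have := ler_norm (p.[a + e] - p.[a]).
have -> : a < a + e < b by apply/andP; split; lra.
by move=> h1 /(_ isT); lra.
Qed.

Lemma poly_ge0_left (p : {poly R}) (a b : R) :
  a < b -> (forall t, a < t < b -> 0 <= p.[t]) -> 0 <= p.[b].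
Proof.
move=> ab p0; have := @poly_ge0_right (p \Po (- 'X)) (- b) (- a).
rewrite horner_comp !hornerE opprK ltrN2; apply=> // t /andP[bt ta].
by rewrite horner_comp !hornerE p0 // ltrNr ta ltrNl bt.
Qed.

Lemma poly_nonroot_itv (p : {poly R}) (a b : R) :
  p != 0 -> a < b -> exists2 t, a < t < b & p.[t] != 0.
Proof.
move=> p0 ab; pose t (i : nat) := a + (b - a) / i.+2%:R.
have [/allP h|/allPn[_ /mapP[i _ ->] ti]] := boolP (all (root p) (map t (iota 0 (size p)))).
  have := max_poly_roots p0 (rs := map t (iota 0 (size p))).
  rewrite size_map size_iota ltnn => H; suff // : false by [].
  apply: H; first exact/allP.
  rewrite map_inj_uniq ?iota_uniq // => i j /addrI.
  move/(mulfI (_ : b - a != 0)); rewrite subr_eq0 gt_eqF // => /(_ isT).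
  by move/invr_inj/eqP; rewrite eqr_nat => /eqP [].
exists (t i) => //; have i0 : 0 < (b - a) / i.+2%:R by rewrite divr_gt0 ?subr_gt0 ?ltr0n.
rewrite ltrDl i0 /= /t -ltrBrDl ltr_pdivrMr ?ltr0n //.
by rewrite ltr_pMr ?subr_gt0 // ltr1n.
Qed.

Lemma Im_horner_real (g : {poly C}) :
  exists p : {poly R}, forall t, Im g.[t%:C] = p.[t].
Proof.
exists (\poly_(i < size g) Im g`_i) => t.
rewrite horner_poly horner_coef raddf_sum; apply: eq_bigr => i _.
have -> : g`_i * t%:C ^+ i = (t ^+ i)%:C * g`_i by rewrite rmorphXn mulrC.
by rewrite -[LHS]/(Im _) Im_realM mulrC.
Qed.

(** Substitute [z = y + t u] with [t > 0] in the hypothesis, divide by [t ^ m] and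
    let [t] tend to 0. Both sides are polynomial in [t], so the limit is the
    value at 0. *)
Lemma local_sign (T h : {poly R}) (y s : R) (m : nat) (u : C) :
    T = h * ('X - y%:P) ^+ m -> 0 < Im u ->
    (forall z, 0 < Im z -> 0 <= Im (T^C.[s%:C * z] * conjc T^C.[z])) ->
  0 <= T.[s * y] * h.[y] * Im (conjc u ^+ m).
Proof.
move=> TE u0 hT.
pose g := (conjc u ^+ m) *: ((T^C \Po (s%:C *: (y%:C%:P + u *: 'X)))
   * (h^C \Po (y%:C%:P + conjc u *: 'X))).
have gE (t : C) :
    g.[t] = conjc u ^+ m * (T^C.[s%:C * (y%:C + u * t)] * h^C.[y%:C + conjc u * t]).
  by rewrite hornerZ hornerM !horner_comp !(hornerZ, hornerD, hornerC, hornerX).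
have [p pE] := Im_horner_real g.
have -> : T.[s * y] * h.[y] * Im (conjc u ^+ m) = p.[0].
  rewrite -Im_realM -pE gE !mulr0 !addr0; congr (Im _).
  by rewrite mulrC -rmorphM !horner_map -rmorphM.
apply: (@poly_ge0_right _ _ 1) => // t /andP[t0 _].
rewrite -(pmulr_rge0 _ (exprn_gt0 m t0)) -pE -Im_realM.
have z0 : 0 < Im (y%:C + u * t%:C).
  by rewrite raddfD /= add0r mulrC Im_realM mulr_gt0.
apply: le_trans (hT _ z0) _; rewrite conjc_horner gE.
rewrite rmorphD /= oppr0 rmorphM /= oppr0.
rewrite [in X in _ * X]TE rmorphM rmorphXn /= map_polyXsubC hornerM horner_exp hornerXsubC.
rewrite [y%:C + _ - _]addrC addKr exprMn rmorphXn.
rewrite le_eqVlt; apply/orP; left; apply/eqP; congr (Im _); ring.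
Qed.

(** For [m > 1] every nonreal number is the [m]-th power of a point of the upper
    half-plane, so the imaginary part takes both signs: [m]-th roots of [i] and
    of [-i] are witnesses. *)
Lemma conj_power_both_signs (c : R) (m : nat) : (1 < m)%N ->
  (forall u : C, 0 < Im u -> 0 <= c * Im (conjc u ^+ m)) -> c = 0.
Proof.
move=> m1 hc.
have root_sign (e : R) : e != 0 -> exists2 u : C, 0 < Im u & Im (conjc u ^+ m) = - e.
  move=> e0; pose w : C := m.-root (Complex 0 e).
  have wm : w ^+ m = Complex 0 e by rewrite rootCK // ltnW.
  exists w; last by rewrite -rmorphXn wm.
  have w0 : 0 <= Im w by have := Im_rootC_ge0 (Complex 0 e) m1; rewrite -complexIm lecR.
  rewrite lt_neqAle w0 andbT eq_sym; apply: contraNneq e0 => wr.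
  have wE : w = (complex.Re w)%:C by case: (w) wr => a b /= ->.
  by move: wm; rewrite wE -rmorphXn => -[_ <-].
have [u u0 uE] := root_sign 1 (oner_neq0 _).
have N1_neq0 : -1 != 0 :> R by rewrite oppr_eq0 oner_neq0.
have [u' u'0 u'E] := root_sign (-1) N1_neq0.
have := hc u u0; have := hc u' u'0; rewrite uE u'E; lra.
Qed.

(** At a root of multiplicity [m > 1] the quotient [T(s z) / T(z)] has a pole of
    order [m], near which it takes all angles, unless [T(s y) = 0]; this cannot
    happen for all [s] of an interval. *)
Lemma angle_simple_roots (T h : {poly R}) (y s0 : R) (m : nat) :
    T = h * ('X - y%:P) ^+ m -> h.[y] != 0 -> 0 < y -> s0 < 1 ->
    (forall s z, s0 <= s < 1 -> 0 < Im z ->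
       0 <= Im (T^C.[s%:C * z] * conjc T^C.[z])) ->
  (m <= 1)%N.
Proof.
move=> TE hy y0 s01 hT; rewrite leqNgt; apply/negP => m1.
have T0 : T != 0.
  rewrite TE mulf_neq0 ?expf_neq0 ?polyXsubC_eq0 //.
  by apply: contraNneq hy => ->; rewrite horner0.
have [|t /andP[t1 t2] Tt] := @poly_nonroot_itv T (s0 * y) y T0.
  by rewrite gtr_pMl.
have : T.[t] * h.[y] = 0.
  apply: (conj_power_both_signs m1) => u u0.
  rewrite -[in T.[t]](divfK (lt0r_neq0 y0) t).
  apply: local_sign TE u0 _ => z z0; apply: hT => //.
  by rewrite ler_pdivlMr // ltr_pdivrMr // mul1r t2 ltW.
by move/eqP; rewrite mulf_eq0 (negbTE Tt) (negbTE hy).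
Qed.

Lemma simple_cofactor (T h : {poly R}) (y s0 : R) :
    T = h * ('X - y%:P) -> T != 0 -> 0 < y -> s0 < 1 ->
    (forall s z, s0 <= s < 1 -> 0 < Im z ->
       0 <= Im (T^C.[s%:C * z] * conjc T^C.[z])) ->
  h.[y] != 0.
Proof.
move=> TE T0 y0 s01 hT; apply/negP => hy.
have [g hE] := factor_theorem h y hy.
have [m [q]] := multiplicity_XsubC g y.
have g0 : g != 0 by apply: contraNneq T0 => g0; rewrite TE hE g0 !mul0r.
rewrite g0 /= => qy gE.
suff : (m.+2 <= 1)%N by [].
apply: (angle_simple_roots _ qy y0 s01 hT).
by rewrite TE hE gE !exprSr !mulrA.
Qed.

(** At the simple root [y'], [local_sign] in the direction [u = i] shows that [T]
    has constant sign, up to zeros, between [s0 * y'] and [y']. If [y] were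
    strictly between these two points, [T] would change sign at the simple root
    [y]. *)
Lemma angle_root_gap (T g : {poly R}) (y y' s0 : R) :
    T = g * ('X - y%:P) * ('X - y'%:P) -> T != 0 -> 0 < y <= y' -> s0 < 1 ->
    (forall s z, s0 <= s < 1 -> 0 < Im z ->
       0 <= Im (T^C.[s%:C * z] * conjc T^C.[z])) ->
  y <= s0 * y'.
Proof.
move=> TE T0 /andP[y0 yy'] s01 hT; rewrite leNgt; apply/negP => y's.
have y'0 := lt_le_trans y0 yy'.
have := simple_cofactor TE T0 y'0 s01 hT.
have : g.[y] * (y - y') != 0.
  have TE' : T = g * ('X - y'%:P) * ('X - y%:P) by rewrite TE mulrAC.
  by have := simple_cofactor TE' T0 y0 s01 hT; rewrite hornerM hornerXsubC.
rewrite hornerM hornerXsubC mulf_eq0 negb_or => /andP[gy yy'0] hy'.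
have {}yy' : y < y' by rewrite lt_neqAle yy' andbT -subr_eq0.
set c := _ * _ in hy'.
have sgnT t : s0 * y' < t < y' -> T.[t] * c <= 0.
  case/andP=> t1 t2; rewrite -oppr_ge0 -mulrN1.
  have -> : -1 = Im (conjc 'i%C ^+ 1) by [].
  have -> : c = (g * ('X - y%:P)).[y'] by rewrite hornerM hornerXsubC.
  rewrite -[in T.[t]](divfK (lt0r_neq0 y'0) t).
  apply: (@local_sign T (g * ('X - y%:P)) y' _ 1 'i%C) => //=.
  move=> z z0; apply: hT => //.
  by rewrite ler_pdivlMr // ltr_pdivrMr // mul1r t2 ltW.
have ge : 0 <= (c *: g).[y].
  apply: (@poly_ge0_right _ _ y') => // t /andP[t1 t2].
  have := sgnT t; rewrite t2 (lt_trans y's t1) => /(_ isT).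
  rewrite TE !hornerM !hornerXsubC hornerZ => h.
  rewrite -(nmulr_lle0 _ (_ : (t - y) * (t - y') < 0)).
    by apply: le_trans h; rewrite le_eqVlt; apply/orP; left; apply/eqP; ring.
  by rewrite pmulr_rlt0 ?subr_gt0 // subr_lt0.
have le : 0 <= (- c *: g).[y].
  apply: (@poly_ge0_left _ (s0 * y')) => // t /andP[t1 t2].
  have := sgnT t; rewrite t1 (lt_trans t2 yy') => /(_ isT).
  rewrite TE !hornerM !hornerXsubC hornerZ => h.
  rewrite -(pmulr_lge0 _ (_ : 0 < (t - y) * (t - y'))).
    rewrite -oppr_le0; apply: le_trans h; rewrite le_eqVlt; apply/orP; left; apply/eqP; ring.
  by rewrite nmulr_rgt0 ?subr_lt0 // (lt_trans t2).
have : c * g.[y] == 0.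
  by move: ge le; rewrite !hornerZ mulNr oppr_ge0 eq_le => -> ->.
by rewrite mulf_eq0 (negbTE hy') (negbTE gy).
Qed.

(** * The product of two polynomials with roots of constant sign *)

Lemma real_root_in (p : {poly R}) (e : R) (l : seq R) (z : C) :
    p = e *: \prod_(r <- l) ('X - r%:P) -> e != 0 -> p^C.[z] = 0 ->
  exists2 r, r \in l & z = r%:C.
Proof.
move=> -> e0; rewrite horner_map_prod_roots => /eqP.
rewrite mulf_eq0 fmorph_eq0 (negbTE e0) /=.
by rewrite prodf_seq_eq0 => /hasP[r rl]; rewrite subr_eq0 => /eqP ->; exists r.
Qed.

Lemma prod_roots_neq0 (p : {poly R}) (e : R) (l : seq R) :
  p = e *: \prod_(r <- l) ('X - r%:P) -> e != 0 -> p != 0.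
Proof.
move=> -> e0; rewrite scaler_eq0 (negbTE e0) /=.
by rewrite monic_neq0 // monic_prod_XsubC.
Qed.

Lemma prod_roots_coef0_neq0 (p : {poly R}) (e w : R) (l : seq R) :
    p = e *: \prod_(r <- l) ('X - r%:P) -> e != 0 ->
  {in l, forall r, 0 < w * r} -> p`_0 != 0.
Proof.
move=> pE e0 hl; rewrite -horner_coef0; apply/eqP => p0.
have [|r rl /complexI r0] := real_root_in (z := 0%:C) pE e0.
  by rewrite horner_map p0.
by have := hl _ rl; rewrite -r0 mulr0 ltxx.
Qed.

Section Product.
Variables (P Q : {poly R}) (c d sg tg : R) (rs qs : seq R).
Hypotheses (PE : P = c *: \prod_(r <- rs) ('X - r%:P))
           (QE : Q = d *: \prod_(q <- qs) ('X - q%:P)).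
Hypotheses (c0 : c != 0) (d0 : d != 0) (sizeE : size rs = size qs).
Hypotheses (sg2 : sg ^+ 2 = 1) (tg2 : tg ^+ 2 = 1).
Hypotheses (rs_gt0 : {in rs, forall r, 0 < sg * r})
           (qs_gt0 : {in qs, forall q, 0 < tg * q}).

(** Two families of half-planes avoid the roots of [P]: the upper and the lower
    one, because the roots are real, and the half-plane of the real parts of
    sign opposite to [sg]. The former exclude nonreal roots of the product, the
    latter excludes real roots of the sign of [sg * tg]. *)
Lemma szego_roots_sign (z : C) : (szego (size qs) P Q)^C.[z] = 0 ->
  exists2 x, 0 < - (sg * tg) * x & z = x%:C.
Proof.
move=> Sz.
have Pn0 : P^C != 0 by rewrite map_poly_eq0 (prod_roots_neq0 PE c0).
have szP : (size P^C <= (size qs).+1)%N.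
  by rewrite size_map_poly PE size_scale // size_prod_XsubC sizeE.
have stable v : (forall r, r \in rs -> Im (v * r%:C) <= 0) ->
    ~ {in qs, forall q, Im (v * z) * q < 0}.
  move=> hv hq; move/eqP: Sz; apply/negP; rewrite map_szego QE.
  apply: (szego_half_plane d0 Pn0 szP _ hq) => x vx; apply/eqP => Px.
  have [r rrs xE] := real_root_in PE c0 Px.
  by move: vx; rewrite xE ltNge hv.
have [zr|zi] := eqVneq (Im z) 0; last first.
  (* the upper or the lower half-plane, according to the sign of - tg * Im z *)
  case: (@stable (- (tg * Im z))%:C) => [r _|q qq].
    by rewrite Im_realM mulr0.
  rewrite Im_realM (_ : _ * _ = - ((tg * q) * Im z ^+ 2)); last by ring.
  by rewrite oppr_lt0 mulr_gt0 ?qs_gt0 // exprn_even_gt0.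
have zE : z = (complex.Re z)%:C by case: (z) zr => a b /= ->.
exists (complex.Re z) => //; set x := complex.Re z in zE *.
have x0 : x != 0.
  apply: contra_eq_neq Sz => xz; rewrite zE xz horner_map fmorph_eq0 horner_coef0.
  rewrite coef_poly /= bin0 divr1.
  by rewrite mulf_neq0 ?(prod_roots_coef0_neq0 PE c0 rs_gt0)
    ?(prod_roots_coef0_neq0 QE d0 qs_gt0).
have sg0 : sg != 0 by rewrite -sqrf_eq0 sg2 oner_neq0.
have tg0 : tg != 0 by rewrite -sqrf_eq0 tg2 oner_neq0.
rewrite mulNr oppr_gt0 ltNge; apply/negP => x_ge0.
have {x_ge0} x_gt0 : 0 < sg * tg * x by rewrite lt_neqAle eq_sym !mulf_neq0.
(* the half-plane where sg * Re x < 0 *)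
case: (@stable (Complex 0 (- sg))) => [r rr|q qq].
  by rewrite /= mul0r add0r mulNr oppr_le0 ltW // rs_gt0.
rewrite zE /= mul0r add0r mulNr mulNr oppr_lt0.
have -> : sg * x * q = (sg * tg * x) * (tg * q).
  by rewrite -[LHS]mul1r -tg2; ring.
by rewrite mulr_gt0 // qs_gt0.
Qed.

(** If the angle left [0, pi] at [z], then [w = - S(s z) / S(z)] would have
    positive imaginary part and [S(s X) + w S(X)], the product of
    [P(s X) + w P(X)] with [Q], would vanish at [z]. By [mesh_scaled_angle]
    the polynomial [P(s X) + w P(X)] has no zero in the half-plane of [sg],
    which contradicts [grace_szego]. *)
Lemma szego_angle (S : {poly R}) (s : R) (z : C) :
    S = szego (size qs) P Q ->
    0 < s <= 1 -> sorted (fun x y => `|x| <= s * `|y|) rs ->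
    0 < Im ((- (sg * tg))%:C * z) ->
  0 <= Im (S^C.[s%:C * z] * conjc S^C.[z]).
Proof.
move=> SE s01 rs_mesh z0; rewrite leNgt; apply/negP => lt0.
set A := S^C.[s%:C * z] in lt0; set B := S^C.[z] in lt0.
have B0 : B != 0 by apply: contraTneq lt0 => ->; rewrite rmorph0 mulr0 ltxx.
pose w := - (A / B).
pose f := (P^C \Po (s%:C *: 'X)) + w *: P^C.
have fE x : f.[x] = P^C.[s%:C * x] + w * P^C.[x].
  by rewrite hornerD horner_comp !hornerZ hornerX.
have sq_ge0 (p : C) : 0 <= complex.Re p ^+ 2 + Im p ^+ 2 by rewrite addr_ge0 ?sqr_ge0.
have sq_gt0 (p : C) : p != 0 -> 0 < complex.Re p ^+ 2 + Im p ^+ 2.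
  move=> p0; rewrite lt_neqAle sq_ge0 andbT eq_sym paddr_eq0 ?sqr_ge0 // !sqrf_eq0.
  by apply: contra p0; rewrite eq_complex.
have Im_conj (a p : C) : Im (a * p * conjc p) = Im a * (complex.Re p ^+ 2 + Im p ^+ 2).
  by case: a => a1 a2; case: p => p1 p2 /=; ring.
have w0 : 0 < Im w.
  rewrite raddfN oppr_gt0 -(pmulr_llt0 _ (sq_gt0 _ B0)) -Im_conj.
  by rewrite divfK.
have f_nz x : 0 < Im (sg%:C * x) -> f.[x] != 0.
  move=> x0; apply/eqP; rewrite fE => /eqP; rewrite addr_eq0 => /eqP fx.
  have Px : P^C.[x] != 0.
    apply/eqP => /(real_root_in PE c0)[r _ xr].
    by move: x0; rewrite xr Im_realM mulr0 ltxx.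
  have := mesh_scaled_angle PE sg2 s01 rs_gt0 rs_mesh x0.
  rewrite fx -mulNr Im_conj leNgt pmulr_llt0 ?sq_gt0 //.
  by rewrite raddfN oppr_lt0 w0.
have f0 : f != 0.
  have sgi : 0 < Im (sg%:C * (sg%:C * 'i%C)).
    by rewrite !Im_realM /= mulr1 -expr2 sg2.
  by apply: contraNneq (f_nz _ sgi) => ->; rewrite horner0.
have szP : (size P^C <= (size qs).+1)%N.
  by rewrite size_map_poly PE size_scale // size_prod_XsubC sizeE.
have szf : (size f <= (size qs).+1)%N.
  apply/leq_sizeP => j qj; rewrite coefD coefZ coef_comp_scale.
  by rewrite (nth_default _ (leq_trans szP qj)) mulr0 mul0r addr0.
have := @szego_half_plane sg%:C f d qs z d0 f0 szf f_nz.
rewrite -QE szegoDl szegoZl szego_comp_scale -map_szego.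
rewrite hornerD horner_comp !hornerZ hornerX -SE -/A -/B /w mulNr divfK // subrr eqxx.
suff hq : {in qs, forall q, Im (sg%:C * z) * q < 0} by move=> /(_ hq).
move=> q qq; move: z0; rewrite !Im_realM => z0.
have -> : sg * Im z * q = - ((- (sg * tg) * Im z) * (tg * q)).
  by rewrite -[LHS]mul1r -tg2; ring.
by rewrite oppr_lt0 mulr_gt0 // qs_gt0.
Qed.

End Product.
End HalfPlane.

(** * Ordered root lists and the logarithmic mesh *)

Section RealRoots.
Variable R : realType.
Local Notation C := R[i].
Local Notation "p ^C" :=
  (map_poly (real_complex R) p) (at level 1, format "p ^C").

Lemma ordered_rootsP (P : {poly R}) : P != 0 -> roots_real_same_sign P ->
  is_ordered_root_list P (ordered_roots P) /\
  exists2 sg : R, sg ^+ 2 = 1 & {in ordered_roots P, forall r, 0 < sg * r}.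
Proof.
move=> P0 hP.
have {hP} [sg sg2 hP] : exists2 sg : R, sg ^+ 2 = 1 &
    forall z : C, root P^C z -> exists2 x : R, 0 < sg * x & z = real_complex R x.
  case: hP => hP; [exists 1; rewrite ?expr1n //|exists (-1); rewrite ?sqrrN ?expr1n //] => z.
    by move=> /hP[x x0 ->]; exists x; rewrite ?mul1r.
  by move=> /hP[x x0 ->]; exists x; rewrite ?mulN1r ?oppr_gt0.
have ex_list : exists s, is_ordered_root_list P s.
  have [zs PE] := closed_field_poly_normal P^C.
  have zsE : zs = [seq real_complex R x | x <- [seq complex.Re z | z <- zs]].
    rewrite -map_comp -[LHS]map_id; apply/eq_in_map => z zz /=.
    have [|x _ -> //] := hP z.
    by rewrite PE rootZ ?lead_coef_eq0 ?map_poly_eq0 // root_prod_XsubC.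
  exists (sort (fun x y : R => `|x| <= `|y|) [seq complex.Re z | z <- zs]).
  split; last by apply: sort_sorted => x y; exact: le_total.
  rewrite (perm_big _ (permEl (perm_sort _ _))) /=.
  apply: (map_poly_inj (real_complex R)).
  rewrite map_polyZ map_prod_XsubC -lead_coef_map {1}PE {1}zsE.
  by rewrite !big_map.
have hord : is_ordered_root_list P (ordered_roots P) by exact: xgetPex ex_list.
split=> //; exists sg => // r rr.
have [|x x0 /complexI -> //] := hP (real_complex R r).
rewrite /root horner_map hord.1 hornerZ fmorph_eq0 mulf_eq0; apply/orP; right.
by rewrite -/(root _ _) root_prod_XsubC.
Qed.

Lemma roots_real_same_signP (P : {poly R}) (sg : R) : sg ^+ 2 = 1 ->
  (forall z, P^C.[z] = 0 -> exists2 x : R, 0 < sg * x & z = real_complex R x) ->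
  roots_real_same_sign P.
Proof.
move=> /eqP; rewrite sqrf_eq1 => /orP[]/eqP -> hP; [left|right] => z /eqP /hP[x x0 ->];
  by exists x; rewrite // ?mul1r ?mulN1r ?oppr_gt0 in x0 *.
Qed.

Lemma size_ordered_roots (P : {poly R}) k :
  size P = k.+1 -> is_ordered_root_list P (ordered_roots P) -> size (ordered_roots P) = k.
Proof.
move=> szP [PE _]; have P0 : P != 0 by rewrite -size_poly_gt0 szP.
by move: szP; rewrite {1}PE size_scale ?lead_coef_eq0 // size_prod_XsubC => -[].
Qed.

Lemma szego_same_sign k (P Q : {poly R}) :
    size P = k.+1 -> size Q = k.+1 ->
    roots_real_same_sign P -> roots_real_same_sign Q ->
  roots_real_same_sign (szego k P Q).
Proof.
move=> szP szQ hP hQ.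
have P0 : P != 0 by rewrite -size_poly_gt0 szP.
have Q0 : Q != 0 by rewrite -size_poly_gt0 szQ.
have [oP [sg sg2 rsP]] := ordered_rootsP P0 hP.
have [oQ [tg tg2 rsQ]] := ordered_rootsP Q0 hQ.
apply: (@roots_real_same_signP _ (- (sg * tg))); first by rewrite sqrrN exprMn sg2 tg2 mulr1.
have sP := size_ordered_roots szP oP; have sQ := size_ordered_roots szQ oQ.
rewrite -sQ; apply: (szego_roots_sign oP.1 oQ.1) => //; rewrite ?lead_coef_eq0 //.
by rewrite sP sQ.
Qed.

(** [angle_root_gap] is applied to the product after the change of variable by
    the sign [rho] of its roots, which makes the roots positive, and with
    [s0 = 1 / q]. *)
Lemma ordered_roots_gap k (P Q : {poly R}) (q : R) (ys : seq R) (j : nat) :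
    ys = ordered_roots (szego k P Q) -> size P = k.+1 -> size Q = k.+1 ->
    roots_real_same_sign P -> roots_real_same_sign Q -> 1 < q ->
    sorted (fun x y => q * `|x| <= `|y|) (ordered_roots P) ->
    (j.+1 < k)%N ->
  q * `|ys`_j| <= `|ys`_j.+1|.
Proof.
move=> ysE0; set S := szego k P Q in ysE0.
move=> szP szQ hP hQ q1 meshP jk.
have P0 : P != 0 by rewrite -size_poly_gt0 szP.
have Q0 : Q != 0 by rewrite -size_poly_gt0 szQ.
have szS : size S = k.+1 by exact: size_szego.
have S0 : S != 0 by rewrite -size_poly_gt0 szS.
have [oP [sg sg2 rsP]] := ordered_rootsP P0 hP.
have [oQ [tg tg2 rsQ]] := ordered_rootsP Q0 hQ.
have [oS _] := ordered_rootsP S0 (szego_same_sign szP szQ hP hQ).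
have sP := size_ordered_roots szP oP; have sQ := size_ordered_roots szQ oQ.
have sS := size_ordered_roots szS oS; rewrite -ysE0 in oS sS.
have sPQ : size (ordered_roots P) = size (ordered_roots Q) by rewrite sP sQ.
have lP : lead_coef P != 0 by rewrite lead_coef_eq0.
have lQ : lead_coef Q != 0 by rewrite lead_coef_eq0.
pose rho := - (sg * tg).
have rho2 : rho ^+ 2 = 1 by rewrite sqrrN exprMn sg2 tg2 mulr1.
have ysE i : (i < k)%N -> `|ys`_i| = rho * ys`_i /\ 0 < rho * ys`_i.
  move=> ik; have yi : ys`_i \in ys by rewrite mem_nth ?sS.
  have [|x x0 /complexI yx] :=
      @szego_roots_sign _ P Q _ _ sg tg _ _ oP.1 oQ.1 lP lQ sPQ sg2 tg2 rsP rsQ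
        (real_complex R ys`_i).
    apply/eqP; rewrite sQ horner_map fmorph_eq0 -/S oS.1 hornerZ mulf_eq0.
    by apply/orP; right; rewrite -/(root _ _) root_prod_XsubC.
  rewrite yx; split=> //; rewrite -(gtr0_norm x0) normrM.
  suff -> : `|- (sg * tg)| = 1 by rewrite mul1r.
  by apply/eqP; rewrite -(@eqrXn2 _ 2) // -normrX rho2 normr1 expr1n.
have jk' := ltnW jk.
have [yjE yj0] := ysE j jk'; have [yj1E yj10] := ysE _ jk.
rewrite -ler_pdivlMl ?(lt_trans ltr01) //.
pose T := S \Po (rho *: 'X).
have TE (z : C) : T^C.[z] = S^C.[real_complex R rho * z].
  by rewrite map_comp_poly horner_comp map_polyZ map_polyX hornerZ hornerX.
have [g SE] : exists g, S = g * ('X - (ys`_j)%:P) * ('X - (ys`_j.+1)%:P).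
  have ysC : ys = take j ys ++ [:: ys`_j, ys`_j.+1 & drop j.+2 ys].
    by rewrite -!drop_nth ?sS // cat_take_drop.
  rewrite oS.1 [X in \prod_(_ <- X) _]ysC big_cat !big_cons /=.
  set a := \prod_(_ <- take _ _) _; set b := \prod_(_ <- drop _ _) _.
  by exists (lead_coef S *: (a * b)); rewrite -!mul_polyC; ring.
rewrite yjE yj1E.
apply: (@angle_root_gap _ T (g \Po (rho *: 'X))).
- rewrite /T SE !comp_polyM !comp_polyB !comp_polyX !comp_polyC.
  have XE a : rho *: 'X - a%:P = rho *: ('X - (rho * a)%:P).
    by rewrite scalerBr scale_polyC mulrA -expr2 rho2 mul1r.
  by rewrite !XE -!scalerAr -!scalerAl scalerA -expr2 rho2 scale1r.
- rewrite -size_poly_gt0 size_comp_poly2 ?szS // size_scale ?size_polyX //.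
  by rewrite -sqrf_eq0 rho2 oner_neq0.
- rewrite yj0 /= -yjE -yj1E.
  have /(sortedP 0) := oS.2; apply; by rewrite sS.
- by rewrite invf_lt1 // (lt_trans ltr01).
- move=> s z /andP[qs s1] z0; rewrite !TE.
  have s0 : 0 < s by apply: lt_le_trans qs; rewrite invr_gt0 (lt_trans ltr01).
  rewrite mulrCA; apply: (szego_angle oP.1 oQ.1 lP lQ sPQ sg2 tg2 rsP rsQ).
  + by rewrite sQ.
  + by rewrite s0 ltW.
  + apply: sub_sorted meshP => x y h.
    apply: le_trans (ler_wpM2r (normr_ge0 y) qs).
    by rewrite ler_pdivlMl // (lt_trans ltr01).
  + by rewrite -/rho mulrA -rmorphM -expr2 rho2 mul1r.
Qed.

(** The mesh of [P] may be infinite, so a violated inequality is first witnessed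
    by a real [q] strictly above the small ratio and not above that mesh. *)
Lemma lmesh_szego_ge k (P Q : {poly R}) :
    size P = k.+1 -> size Q = k.+1 ->
    roots_real_same_sign P -> roots_real_same_sign Q ->
  (lmesh P <= lmesh (szego k P Q))%E.
Proof.
move=> szP szQ hP hQ.
have szS := size_szego szP szQ.
have hS := szego_same_sign szP szQ hP hQ.
have P0 : P != 0 by rewrite -size_poly_gt0 szP.
have S0 : szego k P Q != 0 by rewrite -size_poly_gt0 szS.
have [oP [sg _ rsP]] := ordered_rootsP P0 hP.
have [oS [rho _ rsS]] := ordered_rootsP S0 hS.
have sS := size_ordered_roots szS oS.
apply: le_bigmin => [|[j /= jS] _]; first exact: leey.
have jk : (j.+1 < k)%N by rewrite sS in jS; case: (k) jS.
set ys := ordered_roots (szego k P Q).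
rewrite leNgt; apply/negP => ltq.
have [q ltq' leq] : exists2 q : R, `|ys`_j.+1| / `|ys`_j| < q & (q%:E <= lmesh P)%E.
  case: (lmesh P) ltq => [r|_|//]; first by rewrite lte_fin => ?; exists r.
  by exists (`|ys`_j.+1| / `|ys`_j| + 1); rewrite ?ltrDl ?leey.
have meshP : sorted (fun x y => q * `|x| <= `|y|) (ordered_roots P).
  apply/(sortedP 0) => i iP.
  have iP' : (i < (size (ordered_roots P)).-1)%N by case: size iP.
  have := le_trans leq (bigmin_le _ (Ordinal iP') _).
  rewrite /= lee_fin ler_pdivlMr // normr_gt0.
  have := rsP _ (mem_nth 0 (ltnW iP)); apply: contraTneq => ->.
  by rewrite mulr0 ltxx.
have yj0 : ys`_j != 0.
  have := rsS _ (mem_nth 0 (_ : (j < size (ordered_roots (szego k P Q)))%N)).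
  by rewrite sS ltnW // => /(_ isT); apply: contraTneq => ->; rewrite mulr0 ltxx.
have q1 : 1 < q.
  apply: le_lt_trans ltq'; rewrite ler_pdivlMr ?normr_gt0 // mul1r.
  by have /(sortedP 0) := oS.2; apply; rewrite sS.
have := @ordered_roots_gap k P Q q ys j erefl szP szQ hP hQ q1 meshP jk.
by rewrite -ler_pdivlMr ?normr_gt0 // leNgt ltq'.
Qed.

End RealRoots.

Theorem theorem6 (R : realType) (k : nat) (P Q : {poly R})
    (degP : size P = k.+1) (degQ : size Q = k.+1)
    (rootsP : roots_real_same_sign P) (rootsQ : roots_real_same_sign Q) :
  roots_real_same_sign (schur_szego k P Q) /\
  (Order.max (lmesh P) (lmesh Q) <= lmesh (schur_szego k P Q))%E.
Proof.
rewrite schur_szegoE; split; first exact: szego_same_sign.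
by rewrite ge_max lmesh_szego_ge // szegoC lmesh_szego_ge.
Qed.
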